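(* Let $N, D, d\ge 1$ be integers. For $i=1,\dots,d$ let $A_i\in\mathbb{R}^{N\times N}$, $B_i\in\mathbb{R}^{D\times D}$; for $i=1,\dots,d-1$ let $C_i\in\mathbb{R}^{N\times N}$, $D_i\in\mathbb{R}^{D\times D}$; let $W\in\mathbb{R}^{N\times D\times d}$ and $L\in\mathbb{R}^{N\times D}$. For $X\in\mathbb{R}^{N\times D}$ define $Y_i = A_i X B_i$ for $1\le i\le d$, $Z_1=Y_1$, $Z_{i+1}=(C_i Z_i D_i)\odot Y_{i+1}$ for $1\le i\le d-1$, and $$[P]_{m,n} = \sum_{i=1}^d [W]_{m,n,i}\,[Z_i]_{m,n} + [L]_{m,n},\qquad 1\le m\le N,\ 1\le n\le D.$$ Then for every $(m,n)$ the entry $[P]_{m,n}$ is a polynomial of total degree at most $d$ in the entries of $X$, i.e. $$[P]_{m,n} = \sum_{k\in\mathbb{N}^{N\times D}:\ |k|\le d} \pi_k^{(m,n)}\, x^k,$$ where each coefficient $\pi_k^{(m,n)}$ is a polynomial function of the parameters (the entries of $A_i,B_i,C_i,D_i,W,L$) and does not depend on $X$.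
   Context: $\odot$ is the Hadamard (entrywise) product. $\mathbb{N}$ includes $0$. For a multi-index $k\in\mathbb{N}^{N\times D}$, $|k|=\sum_{m=1}^N\sum_{n=1}^D k_{m,n}$ and $x^k=\prod_{m=1}^N\prod_{n=1}^D x_{m,n}^{k_{m,n}}$, where $x_{m,n}$ are the entries of $X$. *)

(* Defs.v *)
From HB Require Import structures.
From mathcomp Require Import all_boot all_order all_algebra.
From mathcomp Require Import reals.
From mathcomp Require mpoly.

Set Implicit Arguments.
Unset Strict Implicit.
Unset Printing Implicit Defensive.

Import GRing.Theory.
Local Open Scope ring_scope.

Definition hadamard (R : pzSemiRingType) (m n : nat) (A B : 'M[R]_(m, n)) :
  'M[R]_(m, n) := \matrix_(i, j) (A i j * B i j).

(* Layer indices are 0-based: [pA P i] is the matrix usually written A_(i+1). *)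
Record params (R : Type) (N D d : nat) := Params {
  pA : 'I_d -> 'M[R]_N;
  pB : 'I_d -> 'M[R]_D;
  pC : 'I_d.-1 -> 'M[R]_N;
  pD : 'I_d.-1 -> 'M[R]_D;
  pW : 'I_N -> 'I_D -> 'I_d -> R;
  pL : 'M[R]_(N, D)
}.

Section Network.
Variables (R : pzSemiRingType) (N D d : nat).
Variables (P : params R N D d) (X : 'M[R]_(N, D)).

Definition layerY (i : 'I_d) : 'M[R]_(N, D) := pA P i *m X *m pB P i.

Lemma pred_layer_subproof (i : nat) : (i.+1 < d)%N -> (i < d.-1)%N.
Proof. by rewrite ltn_predRL. Qed.

Fixpoint layerZ_rec (i : nat) : (i < d)%N -> 'M[R]_(N, D) :=
  match i return (i < d)%N -> 'M[R]_(N, D) with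
  | 0%N => fun lt_0d => layerY (Ordinal lt_0d)
  | j.+1 => fun lt_j1d =>
      let j' := Ordinal (pred_layer_subproof lt_j1d) in
      hadamard (pC P j' *m layerZ_rec (ltnW lt_j1d) *m pD P j')
               (layerY (Ordinal lt_j1d))
  end.

Definition layerZ (i : 'I_d) : 'M[R]_(N, D) := layerZ_rec (ltn_ord i).

Definition outputP : 'M[R]_(N, D) :=
  \matrix_(m, n) (\sum_(i < d) pW P m n i * layerZ i m n + pL P m n).

End Network.

(* One variable for each scalar entry of A, B, C, D, W and L, in this order. *)
Definition param_index (N D d : nat) : finType :=
  (('I_d * 'I_N * 'I_N) + ('I_d * 'I_D * 'I_D)
   + ('I_d.-1 * 'I_N * 'I_N) + ('I_d.-1 * 'I_D * 'I_D)
   + ('I_N * 'I_D * 'I_d) + ('I_N * 'I_D))%type.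

Definition param_value (R : Type) (N D d : nat) (P : params R N D d)
    (v : param_index N D d) : R :=
  match v with
  | inl (inl (inl (inl (inl (i, r, s))))) => pA P i r s
  | inl (inl (inl (inl (inr (i, r, s))))) => pB P i r s
  | inl (inl (inl (inr (i, r, s)))) => pC P i r s
  | inl (inl (inr (i, r, s))) => pD P i r s
  | inl (inr (m, n, i)) => pW P m n i
  | inr (m, n) => pL P m n
  end.

Definition param_poly (R : nzRingType) (N D d : nat) : Type :=
  mpoly.mpoly #|param_index N D d| R.

Definition eval_param (R : comNzRingType) (N D d : nat)
    (p : param_poly R N D d) (P : params R N D d) : R :=
  mpoly.meval (fun j => param_value P (enum_val j)) p.

Definition mi_deg (N D : nat) (k : 'M[nat]_(N, D)) : nat :=
  (\sum_(m < N) \sum_(n < D) k m n)%N.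

Definition mi_monom (R : pzSemiRingType) (N D : nat) (X : 'M[R]_(N, D))
    (k : 'M[nat]_(N, D)) : R :=
  \prod_(m < N) \prod_(n < D) X m n ^+ k m n.

(* The multi-indices k with |k| <= d all have entries at most d, so they are
   the images of the matrices over 'I_d.+1, a finite type to sum over. *)
Definition mi_of_bounded (N D d : nat) (k : 'M['I_d.+1]_(N, D)) :
  'M[nat]_(N, D) := map_mx (@nat_of_ord d.+1) k.

(* Main.v *)
Require Import Defs.
From HB Require Import structures.
From mathcomp Require Import all_boot all_order all_algebra.
From mathcomp Require Import reals.
From mathcomp Require mpoly.
Import -(notations, coercions) mpoly.

Set Implicit Arguments.
Unset Strict Implicit.
Unset Printing Implicit Defensive.

Import GRing.Theory.
Local Open Scope ring_scope.

(** Functions of the parameters and of X that are finite sums of terms (polynomial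
    in the parameters) * x^k with |k| <= e are closed under sums, and products add
    the bounds e.  Parameters have e = 0 and entries of X have e = 1, so each Y_i
    has e = 1; multiplying by C_i and D_i costs nothing and the Hadamard product
    with Y_(i+1) costs one degree, hence Z_i has e = i.  Collecting the terms with
    the same exponent k gives the coefficients. *)

Section MultiIndex.
Variables (R : comNzRingType) (N D : nat).
Implicit Types (k : 'M[nat]_(N, D)) (X : 'M[R]_(N, D)).

Lemma mi_deg0 : mi_deg (0 : 'M[nat]_(N, D)) = 0%N.
Proof. by rewrite /mi_deg; do 2![apply: big1 => ? _]; rewrite mxE. Qed.

Lemma mi_degD k1 k2 : mi_deg (k1 + k2) = (mi_deg k1 + mi_deg k2)%N.
Proof.
rewrite /mi_deg -big_split; apply: eq_bigr => m _ /=.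
by rewrite -big_split; apply: eq_bigr => n _; rewrite mxE.
Qed.

Lemma mi_deg_delta m n : mi_deg (delta_mx m n : 'M[nat]_(N, D)) = 1%N.
Proof.
rewrite /mi_deg (bigD1 m) //= (bigD1 n) //= mxE !eqxx big1 ?big1 //.
  by move=> i /negPf im; apply: big1 => j _; rewrite mxE im.
by move=> j /negPf jn; rewrite mxE jn andbF.
Qed.

(** This is why exponent matrices over ['I_d.+1] suffice to index all monomials of degree at most
    [d]. *)
Lemma mi_deg_entry k m n : (k m n <= mi_deg k)%N.
Proof.
rewrite /mi_deg (bigD1 m) //= (bigD1 n) //= -addnA; exact: leq_addr.
Qed.

Lemma mi_monom0 X : mi_monom X 0 = 1.
Proof. by rewrite /mi_monom; do 2![apply: big1 => ? _]; rewrite mxE expr0. Qed.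

Lemma mi_monomD X k1 k2 : mi_monom X (k1 + k2) = mi_monom X k1 * mi_monom X k2.
Proof.
rewrite /mi_monom -big_split; apply: eq_bigr => m _ /=.
by rewrite -big_split; apply: eq_bigr => n _; rewrite mxE exprD.
Qed.

Lemma mi_monom_delta X m n : mi_monom X (delta_mx m n) = X m n.
Proof.
rewrite /mi_monom (bigD1 m) //= (bigD1 n) //= mxE !eqxx expr1.
rewrite big1 ?big1 ?mulr1 //.
  by move=> i /negPf im; apply: big1 => j _; rewrite mxE im expr0.
by move=> j /negPf jn; rewrite mxE jn andbF expr0.
Qed.

Lemma mi_of_bounded_inj d : injective (@mi_of_bounded N D d).
Proof.
move=> k1 k2 /matrixP eqk; apply/matrixP => m n; apply: val_inj.
by have := eqk m n; rewrite !mxE.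
Qed.

Lemma mi_of_boundedK d k :
  (mi_deg k <= d)%N -> mi_of_bounded (map_mx (@inord d) k) = k.
Proof.
(* [inord] sends values above [d] to 0, so the round trip needs every entry to be at most [d]. *)
move=> kd; apply/matrixP => m n; rewrite !mxE inordK //.
exact: leq_trans (mi_deg_entry k m n) kd.
Qed.

End MultiIndex.

Section Polynomial.
Variables (R : comNzRingType) (N D d : nat).
Local Notation term :=
  (mpoly.mpoly #|param_index N D d| R * 'M[nat]_(N, D))%type.
Implicit Types (F G : params R N D d -> 'M[R]_(N, D) -> R) (s : seq term).

Definition eval_terms s (P : params R N D d) (X : 'M[R]_(N, D)) : R :=
  \sum_(t <- s) eval_param t.1 P * mi_monom X t.2.

(* The list of terms is chosen before [P] and [X], and may repeat exponents. *)
Definition poly_deg_le (e : nat) F : Prop :=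
  exists2 s : seq term, {in s, forall t, (mi_deg t.2 <= e)%N} &
    forall P X, F P X = eval_terms s P X.

(** Stands in for functional extensionality: the closure lemmas yield functions that agree with the
    desired one only pointwise. *)
Lemma poly_deg_le_ext e F G :
  (forall P X, F P X = G P X) -> poly_deg_le e F -> poly_deg_le e G.
Proof. by move=> FG [s sd Fs]; exists s => // P X; rewrite -FG. Qed.

Lemma poly_deg_leW e e' F : (e <= e')%N -> poly_deg_le e F -> poly_deg_le e' F.
Proof. by move=> le_e [s sd Fs]; exists s => // t /sd /leq_trans; apply. Qed.

Lemma poly_deg_le0 e : poly_deg_le e (fun _ _ => 0).
Proof. by exists [::] => // P X; rewrite /eval_terms big_nil. Qed.

Lemma poly_deg_leD e F G :
  poly_deg_le e F -> poly_deg_le e G ->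
  poly_deg_le e (fun P X => F P X + G P X).
Proof.
move=> [s sd Fs] [t td Gt]; exists (s ++ t) => [u|P X].
  by rewrite mem_cat => /orP[/sd|/td].
by rewrite Fs Gt /eval_terms big_cat.
Qed.

Lemma poly_deg_le_sum e (I : Type) (r : seq I)
    (F : I -> params R N D d -> 'M[R]_(N, D) -> R) :
  (forall i, poly_deg_le e (F i)) ->
  poly_deg_le e (fun P X => \sum_(i <- r) F i P X).
Proof.
move=> Fe; elim: r => [|i r IHr].
  by apply: poly_deg_le_ext (poly_deg_le0 e) => P X; rewrite big_nil.
by apply: poly_deg_le_ext (poly_deg_leD (Fe i) IHr) => P X; rewrite big_cons.
Qed.

Lemma eval_paramM (p q : mpoly.mpoly #|param_index N D d| R)
    (P : params R N D d) :
  eval_param (p * q) P = eval_param p P * eval_param q P.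
Proof. exact: rmorphM. Qed.

Lemma poly_deg_leM e1 e2 F G :
  poly_deg_le e1 F -> poly_deg_le e2 G ->
  poly_deg_le (e1 + e2) (fun P X => F P X * G P X).
Proof.
move=> [s sd Fs] [t td Gt].
(* Distributivity: every pair of terms contributes the product of coefficients at the sum of
   exponents. *)
exists [seq ((u.1 * v.1, u.2 + v.2) : term) | u <- s, v <- t].
  by move=> _ /allpairsP[[u v] /= [/sd ue /td ve ->]]; rewrite mi_degD leq_add.
move=> P X; rewrite Fs Gt /eval_terms big_allpairs_dep mulr_suml.
apply: eq_bigr => u _; rewrite mulr_sumr; apply: eq_bigr => v _ /=.
by rewrite mi_monomD eval_paramM mulrACA.
Qed.

Lemma poly_deg_le_param v : poly_deg_le 0 (fun P _ => param_value P v).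
Proof.
(* A single variable at exponent 0; [enum_rank] undoes the [enum_val] in [eval_param]. *)
exists [:: (mpoly.mpolyX R (mpoly.mnm1 (enum_rank v)), 0)] => [t|P X].
  by rewrite inE => /eqP ->; rewrite mi_deg0.
by rewrite /eval_terms big_seq1 mi_monom0 mulr1 /eval_param mpoly.mevalXU enum_rankK.
Qed.

Lemma poly_deg_le_entry m n : poly_deg_le 1 (fun _ X => X m n).
Proof.
exists [:: (mpoly.mpolyC _ 1, delta_mx m n)] => [t|P X].
  by rewrite inE => /eqP ->; rewrite mi_deg_delta.
by rewrite /eval_terms big_seq1 mi_monom_delta /eval_param mpoly.mevalC mul1r.
Qed.

(** An entry of the product is a finite sum of products of entries, so the bounds add; a parameter
    matrix has bound 0 and costs nothing. *)
Lemma poly_deg_le_mulmx p q r e1 e2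
    (A : params R N D d -> 'M[R]_(N, D) -> 'M[R]_(p, q))
    (B : params R N D d -> 'M[R]_(N, D) -> 'M[R]_(q, r)) :
  (forall i j, poly_deg_le e1 (fun P X => A P X i j)) ->
  (forall i j, poly_deg_le e2 (fun P X => B P X i j)) ->
  forall i j, poly_deg_le (e1 + e2) (fun P X => (A P X *m B P X) i j).
Proof.
move=> Ae Be i j.
apply: poly_deg_le_ext (poly_deg_le_sum (index_enum 'I_q)
  (fun l => poly_deg_leM (Ae i l) (Be l j))) => P X.
by rewrite mxE.
Qed.

Lemma layerY_poly i m n : poly_deg_le 1 (fun P X => layerY P X i m n).
Proof.
apply: (@poly_deg_le_mulmx _ _ _ 1 0 (fun P X => pA P i *m X) (fun P _ => pB P i)).
  apply: (@poly_deg_le_mulmx _ _ _ 0 1 (fun P _ => pA P i) (fun _ X => X)).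
    by move=> r s; apply: (poly_deg_le_param (inl (inl (inl (inl (inl (i, r, s))))))).
  exact: poly_deg_le_entry.
by move=> r s; apply: (poly_deg_le_param (inl (inl (inl (inl (inr (i, r, s))))))).
Qed.

(** The bound is [i.+1] because layers are counted from 0: layer 0 is already linear in [X]. *)
Lemma layerZ_rec_poly i (lt_id : (i < d)%N) m n :
  poly_deg_le i.+1 (fun P X => layerZ_rec P X lt_id m n).
Proof.
elim: i lt_id m n => [|i IHi] lt_id m n; first exact: layerY_poly.
set j := Ordinal (pred_layer_subproof lt_id).
have CZD : poly_deg_le (0 + i.+1 + 0) (fun P X =>
    (pC P j *m layerZ_rec P X (ltnW lt_id) *m pD P j) m n).
  apply: (poly_deg_le_mulmx
      (A := fun P X => pC P j *m layerZ_rec P X (ltnW lt_id))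
      (B := fun P _ => pD P j)) => r s.
    apply: (poly_deg_le_mulmx (A := fun P _ => pC P j)
      (B := fun P X => layerZ_rec P X (ltnW lt_id))) => p q; last exact: IHi.
    exact: (poly_deg_le_param (inl (inl (inl (inr (j, p, q)))))).
  exact: (poly_deg_le_param (inl (inl (inr (j, r, s))))).
rewrite addn0 add0n in CZD.
have := poly_deg_leM CZD (layerY_poly (Ordinal lt_id) m n); rewrite addn1.
(* Only the Hadamard entry on the right is expanded; the matrix products inside it stay folded. *)
by apply: poly_deg_le_ext => P X; rewrite [RHS]mxE.
Qed.

Lemma outputP_poly m n : poly_deg_le d (fun P X => outputP P X m n).
Proof.
have WZ i : poly_deg_le d (fun P X => pW P m n i * layerZ P X i m n).
  (* [i < d] is by definition [i.+1 <= d], exactly the weakening required; the added 0 is the degree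
     of the weight. *)
  apply: poly_deg_leW (ltn_ord i) _; rewrite -[i.+1]add0n.
  apply: poly_deg_leM (layerZ_rec_poly _ _ _).
  exact: (poly_deg_le_param (inl (inr (m, n, i)))).
have Lmn := poly_deg_leW (leq0n d) (poly_deg_le_param (inr (m, n))).
apply: poly_deg_le_ext (poly_deg_leD (poly_deg_le_sum (index_enum 'I_d) WZ) Lmn).
by move=> P X; rewrite mxE.
Qed.

Lemma poly_deg_le_coef e F :
  poly_deg_le e F ->
  exists coef : 'M[nat]_(N, D) -> param_poly R N D d, forall P X,
    F P X = \sum_(k : 'M['I_e.+1]_(N, D) | (mi_deg (mi_of_bounded k) <= e)%N)
      eval_param (coef (mi_of_bounded k)) P * mi_monom X (mi_of_bounded k).
Proof.
move=> [s sd Fs].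
(* The coefficient of [k] gathers all terms with exponent [k]. Moving the filter into the summand
   then allows the sums over [k] and [t] to be exchanged. *)
exists (fun k => \sum_(t <- s | t.2 == k) t.1) => P X.
under eq_bigr => k _.
  rewrite /eval_param raddf_sum mulr_suml big_mkcond /=; over.
rewrite exchange_big Fs; apply: eq_big_seq => t /sd te /=.
(* Each term [t] is counted once: at the bounded copy of its exponent, and by injectivity of
   [mi_of_bounded] nowhere else. *)
rewrite (bigD1 (map_mx (@inord e) t.2)) /= mi_of_boundedK // eqxx.
rewrite big1 ?addr0 // => k /andP[_ neq_k]; case: eqP => // tk.
by rewrite -(inj_eq (@mi_of_bounded_inj _ _ _)) mi_of_boundedK // tk eqxx in neq_k.
Qed.

End Polynomial.

Theorem mainTheorem2 (R : realType) (N D d : nat)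
    (N_gt0 : (1 <= N)%N) (D_gt0 : (1 <= D)%N) (d_gt0 : (1 <= d)%N) :
  exists coef : 'I_N -> 'I_D -> 'M[nat]_(N, D) -> param_poly R N D d,
  forall (P : params R N D d) (X : 'M[R]_(N, D)) (m : 'I_N) (n : 'I_D),
    outputP P X m n =
    \sum_(k : 'M['I_d.+1]_(N, D) | (mi_deg (mi_of_bounded k) <= d)%N)
      eval_param (coef m n (mi_of_bounded k)) P * mi_monom X (mi_of_bounded k).
Proof.
(* The index pairs form a finite type, so one coefficient family per entry can be chosen without an
   axiom of choice. *)
have /fin_all_exists[coef coefE] (mn : 'I_N * 'I_D) :=
  poly_deg_le_coef (@outputP_poly R N D d mn.1 mn.2).
by exists (fun m n => coef (m, n)) => P X m n; apply: (coefE (m, n)).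
Qed.
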